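(* Let $G_k$ be a graph containing $k$ odd cycles $C_1,\ldots,C_k$ of length $3$ such that the cycles $C_i$ and $C_j$ have disjoint vertex sets, for every $1\leq i<j\leq k$. Suppose that there exists exactly one path $P_{i,i+1}$ of length $r_i\geq 2$ connecting a vertex of $C_i$ with a vertex of $C_{i+1}$, $1\leq i\leq k-1$. If $G_k$ has no more vertices or edges, then $$\mathrm{ara}(J_{G_k})=\mathrm{ht}(J_{G_k})=2k+\sum_{i=1}^{k-1}r_i.$$ In particular, $J_{G_k}$ is a set-theoretic complete intersection.
   Context: Let $K$ be any field. Graphs are undirected, connected and simple. For such a graph $G$ on the vertex set $[n]=\{1,\ldots,n\}$, the binomial edge ideal $J_G\subset R=K[x_1,\ldots,x_n,x_{n+1},\ldots,x_{2n}]$ is the ideal generated by the binomials $f_{ij}=x_ix_{n+j}-x_jx_{n+i}$, with $i<j$, such that $\{i,j\}$ is an edge of $G$ (for $G_k$, the vertices are labelled by $[n]$ with $n$ the number of vertices of $G_k$). The arithmetical rank $\mathrm{ara}(J)$ of an ideal $J$ is the smallest integer $s$ for which there exist polynomials $F_1,\ldots,F_s\in J$ with $\mathrm{rad}(J)=\mathrm{rad}(F_1,\ldots,F_s)$. $\mathrm{ht}(J)$ denotes the height of $J$. $J_G$ is a set-theoretic complete intersection if $\mathrm{ara}(J_G)=\mathrm{ht}(J_G)$. The length of a path or cycle is its number of edges.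
   Formalization: Assumes k ≥ 2 (for k = 1, G is a triangle with ara 3, ht 2) and that the paths P_{i,i+1} are pairwise vertex-disjoint with interior vertices on no cycle C_j (if two paths meet C_i at the same vertex, or interior vertices are shared, the height is smaller than the formula). *)

(* Defs.v *)
From HB Require Import structures.
From mathcomp Require Import all_boot all_order all_algebra.
From mathcomp Require Import mpoly.

Set Implicit Arguments.
Unset Strict Implicit.
Unset Printing Implicit Defensive.

Import GRing.Theory.
Local Open Scope ring_scope.

(* Ideals are Prop-valued, since membership in an arbitrary ideal (or prime)   *)
(* of a polynomial ring need not be decidable.                                *)
Section Ideals.
Variable R : comNzRingType.
Implicit Types (S I J P Q : R -> Prop).

Definition is_ideal I : Prop :=
  [/\ I 0, forall f g, I f -> I g -> I (f + g) & forall a f, I f -> I (a * f)].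

Definition ideal_gen S : R -> Prop := fun f =>
  exists (m : nat) (a g : 'I_m -> R),
    (forall i, S (g i)) /\ f = \sum_(i < m) a i * g i.

Definition radical I : R -> Prop := fun f => exists m : nat, I (f ^+ m).

Definition is_prime_ideal P : Prop :=
  [/\ is_ideal P, ~ P 1 & forall f g, P (f * g) -> P f \/ P g].

Definition subideal I J : Prop := forall f, I f -> J f.

Definition strict_subideal I J : Prop :=
  subideal I J /\ exists f, J f /\ ~ I f.

(* A strict chain c 0 < c 1 < ... < c h = P of prime ideals. *)
Definition prime_chain (h : nat) P : Prop :=
  exists c : nat -> R -> Prop,
    [/\ forall i, (i <= h)%N -> is_prime_ideal (c i),
        forall i, (i < h)%N -> strict_subideal (c i) (c i.+1)
      & forall f, c h f <-> P f].

Definition prime_height P (h : nat) : Prop :=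
  prime_chain h P /\ forall m, prime_chain m P -> (m <= h)%N.

(* The minimum of the heights of the primes containing J; a prime of infinite  *)
(* height puts no constraint on this minimum.                                 *)
Definition height J (h : nat) : Prop :=
  (exists P, [/\ is_prime_ideal P, subideal J P & prime_height P h]) /\
  (forall Q m, is_prime_ideal Q -> subideal J Q -> prime_height Q m ->
    (h <= m)%N).

Definition cut_out_by J (s : nat) : Prop :=
  exists F : 'I_s -> R,
    (forall i, J (F i)) /\
    (forall f, radical J f <->
       radical (ideal_gen (fun g => exists i, g = F i)) f).

Definition arithmetical_rank J (s : nat) : Prop :=
  cut_out_by J s /\ forall t, cut_out_by J t -> (s <= t)%N.

Definition set_theoretic_complete_intersection J : Prop :=
  exists s : nat, arithmetical_rank J s /\ height J s.

End Ideals.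

Section BinomialEdgeIdeal.
Variables (K : fieldType) (n : nat).

(* x_i is 'X_(lshift n i) and x_{n+j} is 'X_(rshift n j). *)
Definition edge_binomial (i j : 'I_n) : {mpoly K[n + n]} :=
  'X_(lshift n i) * 'X_(rshift n j) - 'X_(lshift n j) * 'X_(rshift n i).

Definition binomial_edge_ideal (e : rel 'I_n) : {mpoly K[n + n]} -> Prop :=
  ideal_gen (fun f => exists i j : 'I_n,
    [/\ (i < j)%N, e i j & f = edge_binomial i j]).

End BinomialEdgeIdeal.

Arguments binomial_edge_ideal K {n} e.

Section Graphs.
Variable T : finType.
Implicit Types (e : rel T) (s c p : seq T) (u v x : T).

Definition connected_simple_graph e : Prop :=
  [/\ ssrbool.symmetric e, irreflexive e & forall u v, connect e u v].

Definition cycle_of_length e (m : nat) c : Prop := ucycle e c /\ size c = m.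

Definition cycle_edge c u v : bool :=
  (u \in c) && (v == next c u) || (v \in c) && (u == next c v).

Definition path_edge s u v : bool := infix [:: u; v] s || infix [:: v; u] s.

(* The path x :: p, of length size p, joins the cycle C i to the cycle C i.+1; *)
(* only its two endpoints lie on the cycles C 0, ..., C k.-1.                 *)
Definition connecting_path e (k : nat) (C : nat -> seq T) (i : nat) x p
    : Prop :=
  [/\ path e x p, uniq (x :: p), x \in C i, last x p \in C i.+1
    & forall j v, (j < k)%N -> v \in behead (belast x p) -> v \notin C j].

(* G is the chain C 0 - P 0 - C 1 - P 1 - ... - C k.-1 of triangles, where the *)
(* connecting path P i has vertices a i :: p i and length r i. The paths are  *)
(* pairwise vertex-disjoint: if two consecutive ones met the triangle between *)
(* them at the same vertex, the height would drop by one.                     *)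
Record triangle_chain e (k : nat) (r : nat -> nat) (C : nat -> seq T)
    (a : nat -> T) (p : nat -> seq T) : Prop := TriangleChain {
  tc_cycle : forall i, (i < k)%N -> cycle_of_length e 3 (C i);
  tc_cycle_disjoint : forall i j, (i < j < k)%N -> [disjoint C i & C j];
  tc_path : forall i, (i < k.-1)%N ->
    connecting_path e k C i (a i) (p i) /\ size (p i) = r i;
  tc_path_unique : forall i x q, (i < k.-1)%N ->
    connecting_path e k C i x q -> x = a i /\ q = p i;
  tc_path_disjoint : forall i j, (i < j < k.-1)%N ->
    [disjoint a i :: p i & a j :: p j];
  tc_vertices : forall v,
    (exists2 i, (i < k)%N & v \in C i) \/
    (exists2 i, (i < k.-1)%N & v \in a i :: p i);
  tc_edges : forall u v, e u v ->
    (exists2 i, (i < k)%N & cycle_edge (C i) u v) \/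
    (exists2 i, (i < k.-1)%N & path_edge (a i :: p i) u v)
}.

End Graphs.

(* Main.v *)
Require Import Defs.
From HB Require Import structures.
From mathcomp Require Import all_boot all_order all_algebra.
From mathcomp Require Import mpoly zify ring.
From Stdlib Require Import ClassicalEpsilon.

(* Consecutive triangles are entered and left at distinct vertices, so the
   graph has a Hamiltonian path [v_1, ..., v_n], and n - 1 is the announced sum.

   Height. Let Q be a prime containing the binomials of the path. Walking along
   the path, each vertex v_i with x_i, y_i in Q adds two steps to a chain of
   primes below Q (kill x_i, then y_i), and each other vertex preceded by one
   not of this kind adds one step (make (x_i, y_i) proportional to the start of
   its run). This gives at least n - 1 steps. Conversely, the prime of the
   generic 2 x n matrix of rank 1 lies n + 1 steps below the maximal ideal of
   the origin, and chains of primes have length at most 2n.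

   Arithmetical rank, lower bound. If F_1, ..., F_t cut out J_G, adding the
   n + 1 linear forms x_1, y_n and x_(i+1) - y_i leaves only the origin, and
   this needs at least 2n equations.

   Upper bound. By the Pluecker relation f_dz f_cq = f_dc f_zq - f_zc f_dq, for
   a triangle dzc with a path edge cq, the four edge binomials generate the same
   radical as f_dc, f_zc and f_dz + f_cq. Since the path lengths are at least 2,
   the triangles use distinct path edges, and each saves one equation. *)

Set Implicit Arguments.
Unset Strict Implicit.
Unset Printing Implicit Defensive.

Import GRing.Theory.

Local Open Scope ring_scope.

(** * Ideals *)

Section IdealTheory.
Variable R : comNzRingType.
Implicit Types (S I J P Q : R -> Prop).

Lemma is_ideal_sum I (T : Type) (s : seq T) (A : pred T) (F : T -> R) :
  is_ideal I -> (forall t, A t -> I (F t)) -> I (\sum_(t <- s | A t) F t).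
Proof. by case=> [I0 ID _] IF; elim/big_ind: _ => //. Qed.

Lemma is_idealN I f : is_ideal I -> I f -> I (- f).
Proof. by move=> [_ _ IM] If; rewrite -mulN1r; apply: IM. Qed.

Lemma is_idealB I f g : is_ideal I -> I f -> I g -> I (f - g).
Proof. by move=> hI If Ig; case: (hI) => _ ID _; apply: ID If _; apply: is_idealN. Qed.

Lemma ideal_gen_is_ideal S : is_ideal (ideal_gen S).
Proof.
split.
- by exists 0%N, (fun _ => 0), (fun _ => 0); split; [case | rewrite big_ord0].
- move=> _ _ [m1 [a1 [g1 [S1 ->]]]] [m2 [a2 [g2 [S2 ->]]]].
  pose sel (b1 : 'I_m1 -> R) (b2 : 'I_m2 -> R) i :=
    match split i with inl j => b1 j | inr j => b2 j end.
  exists (m1 + m2)%N, (sel a1 a2), (sel g1 g2); split.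
    by move=> i; rewrite /sel; case: split.
  rewrite big_split_ord /sel; congr (_ + _); apply: eq_bigr => i _.
    by rewrite (unsplitK (inl _ i)).
  by rewrite (unsplitK (inr _ i)).
- move=> b _ [m [a [g [Sg ->]]]].
  exists m, (fun i => b * a i), g; split => //.
  by rewrite mulr_sumr; apply: eq_bigr => i _; rewrite mulrA.
Qed.

Lemma mem_ideal_gen S f : S f -> ideal_gen S f.
Proof.
by move=> Sf; exists 1%N, (fun _ => 1), (fun _ => f);
  rewrite big_ord1 mul1r.
Qed.

Lemma ideal_gen_min S I :
  is_ideal I -> (forall f, S f -> I f) -> subideal (ideal_gen S) I.
Proof.
move=> hI SI _ [m [a [g [Sg ->]]]]; apply: is_ideal_sum => // i _.
by case: hI => _ _; apply; apply: SI.
Qed.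

Lemma sub_radical I : subideal I (radical I).
Proof. by move=> f If; exists 1%N; rewrite expr1. Qed.

Lemma radical_is_ideal I : is_ideal I -> is_ideal (radical I).
Proof.
move=> hI; case: (hI) => I0 ID IM; split.
- by exists 1%N; rewrite expr1.
- move=> f g [m If] [k Ig]; exists (m + k)%N; rewrite exprDn.
  apply: is_ideal_sum => // i _; rewrite -mulr_natr mulrC; apply: (IM).
  have [le_ki | lt_ik] := leqP k i.
    by rewrite -(subnK le_ki) exprD mulrA; apply: IM.
  rewrite mulrC; apply: (IM).
  by rewrite -addnBA ?(ltnW lt_ik)// addnC exprD; apply: IM.
- by move=> a f [m If]; exists m; rewrite exprMn; apply: IM.
Qed.

Lemma radical_idem I f m : radical I (f ^+ m) -> radical I f.
Proof. by move=> [k If]; exists (m * k)%N; rewrite exprM. Qed.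

Lemma radical_sub I J : subideal I (radical J) -> subideal (radical I) (radical J).
Proof. by move=> IJ f [m /IJ]; apply: radical_idem. Qed.

End IdealTheory.

Lemma ker_is_prime (R : comNzRingType) (S : idomainType) (phi : {rmorphism R -> S}) :
  is_prime_ideal (fun f => phi f = 0).
Proof.
split.
- split=> [|f g f0 g0|a f f0]; first exact: rmorph0.
    by rewrite rmorphD f0 g0 addr0.
  by rewrite rmorphM f0 mulr0.
- by rewrite rmorph1; apply/eqP/oner_neq0.
- move=> f g /eqP; rewrite rmorphM mulf_eq0 => /orP[] /eqP; by [left | right].
Qed.

(** * Prime ideals as kernels of maps to fields *)

Section ClassicalDomain.
Variables (R : comNzRingType).

(** Invertibility is decided by excluded middle and inverses are chosen, so that any integral domain
    becomes an [idomainType] and has a field of fractions. *)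
Definition has_inverse (x : R) : bool :=
  if excluded_middle_informative (exists y, y * x = 1) then true else false.

Definition some_inverse (x : R) : R :=
  match excluded_middle_informative (exists y, y * x = 1) with
  | left ex => proj1_sig (constructive_indefinite_description _ ex)
  | right _ => x
  end.

Lemma some_inverseK : {in has_inverse, left_inverse 1 some_inverse *%R}.
Proof.
move=> x; rewrite /in_mem /= /has_inverse /some_inverse.
by case: excluded_middle_informative => //= ex _; case: constructive_indefinite_description.
Qed.

Lemma has_inverseP x y : y * x = 1 -> has_inverse x.
Proof.
by move=> yx; rewrite /has_inverse; case: excluded_middle_informative => // -[]; exists y.
Qed.

Lemma some_inverse_out : {in [predC has_inverse], some_inverse =1 id}.
Proof.
move=> x; rewrite /in_mem /= /has_inverse /some_inverse.
by case: excluded_middle_informative.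
Qed.

(** The alias carries the proof of integrality, which the instances below read off the type. *)
Definition classical_domain of GRing.integral_domain_axiom R : Type := R.

Hypothesis R_domain : GRing.integral_domain_axiom R.
Local Notation D := (classical_domain R_domain).

HB.instance Definition _ := GRing.ComNzRing.on D.
HB.instance Definition _ := GRing.ComNzRing_hasMulInverse.Build D
  some_inverseK has_inverseP some_inverse_out.
HB.instance Definition _ := GRing.ComUnitRing_isIntegral.Build D R_domain.

End ClassicalDomain.

Section PrimeIsKernel.
Variables (R : comNzRingType) (Q : R -> Prop).
Hypothesis Q_prime : is_prime_ideal Q.

Definition prime_pred (f : R) : bool :=
  if excluded_middle_informative (Q f) then true else false.

Lemma prime_predP f : reflect (Q f) (prime_pred f).
Proof. by rewrite /prime_pred; case: excluded_middle_informative => h; constructor. Qed.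

Lemma prime_pred_idealr : idealr_closed prime_pred.
Proof.
case: Q_prime => -[Q0 QD QM] Q1 _; split.
- exact/prime_predP.
- exact/prime_predP.
- by move=> b f g /prime_predP Qf /prime_predP Qg; apply/prime_predP/QD/Qg/QM.
Qed.

Lemma prime_pred_prime : prime_idealr_closed prime_pred.
Proof.
case: Q_prime => _ _ QM f g /prime_predP /QM [] Qfg; apply/orP.
  by left; apply/prime_predP.
by right; apply/prime_predP.
Qed.

HB.instance Definition _ := isIdealr.Build R prime_pred prime_pred_idealr.
HB.instance Definition _ := isPrimeIdealrClosed.Build R prime_pred prime_pred_prime.

(** [L] is the field of fractions of the quotient by [Q]. Congruences modulo [Q] become equations in
    a field, where division is possible. *)
Lemma prime_is_kernel :
  exists (L : fieldType) (theta : {rmorphism R -> L}), forall f, Q f <-> theta f = 0.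
Proof.
pose I : prime_idealr R := prime_pred; pose B := {ideal_quot I}.
pose D := classical_domain (@Quotient.rquot_IdomainAxiom R I).
pose theta : R -> {fraction D} := @FracField.tofrac D \o (\pi_B)%qT.
have theta0 f : (theta f == 0) = prime_pred f.
  by rewrite [LHS]tofrac_eq0 -[X in _ == X](rmorph0 (\pi_B)%qT) -Quotient.idealrBE subr0.
exists {fraction D}, theta => f; split=> [/prime_predP|/eqP].
  by rewrite -theta0 => /eqP.
by rewrite [_ == 0]theta0 => /prime_predP.
Qed.

End PrimeIsKernel.

(** * Length of chains of primes in a polynomial ring *)

(** This bound and the next are crude, but both are of order [d ^ N], and only the order of growth
    matters later. *)
Lemma card_bmultinom_le N d : (#|{: 'X_{1..N < d}}| <= d ^ N)%N.
Proof.
have lt_d (m : 'X_{1..N < d}) i : (m i < d)%N.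
  by apply: leq_ltn_trans (bmdeg m); rewrite mdegE (bigD1 i) //= leq_addr.
pose f (m : 'X_{1..N < d}) : {ffun 'I_N -> 'I_d} := [ffun i => Ordinal (lt_d m i)].
have -> : (d ^ N)%N = #|{ffun 'I_N -> 'I_d}| by rewrite card_ffun !card_ord.
apply: (leq_card f) => m1 m2 /ffunP eq_m; apply/val_inj/mnmP => i.
by have := eq_m i; rewrite !ffunE => -[].
Qed.

(** The box of exponents at most [q] fits into degree at most [N * q]. *)
Lemma card_bmultinom_ge N q : (q.+1 ^ N <= #|{: 'X_{1..N < (N * q).+1}}|)%N.
Proof.
have deg_f (a : {ffun 'I_N -> 'I_q.+1}) : (mdeg [multinom val (a i) | i < N] < (N * q).+1)%N.
  rewrite ltnS mdegE -[X in (_ <= X * _)%N]card_ord -sum_nat_const.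
  by apply: leq_sum => i _; rewrite mnmE; apply: (leq_ord (a i)).
pose f a : 'X_{1..N < (N * q).+1} := BMultinom (deg_f a).
rewrite -[X in (_ ^ X <= _)%N]card_ord -[X in (X ^ _ <= _)%N]card_ord -card_ffun.
apply: (leq_card f) => a b /(congr1 val) /= /mnmP eq_ab.
by apply/ffunP => i; apply/val_inj; have := eq_ab i; rewrite !mnmE.
Qed.

Section LinearAlgebra.
Variables (K : fieldType) (N : nat).
Local Notation R := {mpoly K[N]}.

(** The rows of coefficients of the [b t], on the monomials of degree less than [d], are linearly
    independent. *)
Lemma card_le_of_indep (T : finType) (b : T -> R) (d : nat) :
  (forall c : T -> K, \sum_t c t *: b t = 0 -> forall t, c t = 0) ->
  (forall t, msize (b t) <= d)%N -> (#|T| <= d ^ N)%N.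
Proof.
move=> b_free b_deg; apply: leq_trans (card_bmultinom_le N d).
pose A := \matrix_(i < #|T|, j < #|{: 'X_{1..N < d}}|) (b (enum_val i))@_(enum_val j).
suff /eqnP <- : row_free A by apply: rank_leq_col.
rewrite -kermx_eq0; apply/eqP/row_matrixP => i; rewrite row0.
set v := row i _; have vA : v *m A = 0 by rewrite -row_mul mulmx_ker row0.
have /b_free v0 : \sum_t v 0 (enum_rank t) *: b t = 0.
  apply/mpolyP => m; rewrite mcoeff0 raddf_sum /=.
  have [lt_md | le_dm] := ltnP (mdeg m) d; last first.
    rewrite big1 // => t _; rewrite mcoeffZ [X in _ * X]memN_msupp_eq0 ?mulr0 //.
    exact/msize_mdeg_ge/(leq_trans (b_deg t)).
  transitivity ((v *m A) 0 (enum_rank (BMultinom lt_md))); last by rewrite vA mxE.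
  rewrite [RHS]mxE (reindex_onto enum_rank enum_val) /=.
    by apply: eq_big => [t|t _]; rewrite ?enum_rankK ?eqxx // mcoeffZ [A _ _]mxE !enum_rankK.
  by move=> j _; rewrite enum_valK.
by apply/rowP => j; rewrite [RHS]mxE -(v0 (enum_val j)) enum_valK.
Qed.

(** Here [w] spans modulo terms of degree at least [d], so the identity matrix on the monomials of
    degree less than [d] factors through a space of dimension [#|T|]. *)
Lemma card_le_of_span (T : finType) (w : T -> R) (d : nat) :
  (forall m, (mdeg m < d)%N -> exists c : T -> K,
    forall m', (mdeg m' < d)%N -> ('X_[m] : R)@_m' = (\sum_t c t *: w t)@_m') ->
  (#|{: 'X_{1..N < d}}| <= #|T|)%N.
Proof.
move=> w_span.
have {}w_span (m : 'X_{1..N < d}) :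
    {c : T -> K | forall m', (mdeg m' < d)%N ->
      ('X_[m] : R)@_m' = (\sum_t c t *: w t)@_m'}.
  by apply: constructive_indefinite_description; apply/w_span/bmdeg.
pose W := \matrix_(i < #|T|, j < #|{: 'X_{1..N < d}}|) (w (enum_val i))@_(enum_val j).
pose C := \matrix_(i < #|{: 'X_{1..N < d}}|, j < #|T|) sval (w_span (enum_val i)) (enum_val j).
have CW : C *m W = 1%:M.
  apply/matrixP => i j; rewrite !mxE.
  rewrite (reindex_onto enum_rank enum_val) /=; last by move=> k _; rewrite enum_valK.
  transitivity (('X_[enum_val i] : R)@_(enum_val j)); last first.
    by rewrite mcoeffX -bmeqP (inj_eq enum_val_inj).
  rewrite (svalP (w_span (enum_val i))) ?bmdeg // raddf_sum /=.
  apply: eq_big => [t|t _]; rewrite ?enum_rankK ?eqxx //.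
  by rewrite mcoeffZ [W _ _]mxE [C _ _]mxE !enum_rankK.
by rewrite -(mxrank1 K #|_|) -CW; apply: leq_trans (mxrankM_maxl _ _) (rank_leq_col _).
Qed.

End LinearAlgebra.

Section PrimeChains.
Variables (K : fieldType) (N : nat).
Local Notation R := {mpoly K[N]}.

Definition indep_mod (Q : R -> Prop) (T : finType) (b : T -> R) : Prop :=
  forall c : T -> K, Q (\sum_t c t *: b t) -> forall t, c t = 0.

(* A relation [\sum_a g ^ a * B_a] in [P], with the [B_a] combinations of [b],
   can be divided by the power of [g] in it, and its constant term is in [Q]. *)
Lemma indep_mod_adjoin (P Q : R -> Prop) (g : R) (T : finType) (b : T -> R) D :
  is_prime_ideal P -> is_ideal Q -> subideal P Q -> Q g -> ~ P g ->
  indep_mod Q b -> indep_mod P (fun s : 'I_D * T => g ^+ s.1 * b s.2).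
Proof.
move=> P_prime Q_ideal PQ Qg Pg b_indep c Pc [a t].
have [m] := ubnP (val a); elim: m => // m IH in a t * => le_am.
pose B (a1 : 'I_D) := \sum_t c (a1, t) *: b t.
have B0 (a1 : 'I_D) : (a1 < a)%N -> B a1 = 0.
  by move=> lt_a; apply: big1 => t1 _; rewrite IH ?scale0r //; apply: leq_trans lt_a le_am.
pose rest := \sum_(a1 < D | (a < a1)%N) g ^+ (a1 - a.+1) * B a1.
have def_sum : \sum_s c s *: (g ^+ s.1 * b s.2) = g ^+ a * (B a + g * rest).
  transitivity (\sum_(a1 < D) g ^+ a1 * B a1).
    transitivity (\sum_(a1 < D) \sum_t c (a1, t) *: (g ^+ a1 * b t)).
      by rewrite pair_bigA; apply: eq_bigr => -[].
    by apply: eq_bigr => a1 _; rewrite mulr_sumr; apply: eq_bigr => t1 _; rewrite scalerAr.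
  rewrite (bigD1 a) //= mulrDr; congr (_ + _).
  rewrite (bigID (fun a1 : 'I_D => a < a1)%N) /= [X in _ + X]big1 ?addr0; last first.
    move=> a1 /andP[ne_a]; rewrite -leqNgt leq_eqVlt (inj_eq val_inj) (negPf ne_a) /=.
    by move/B0->; rewrite mulr0.
  rewrite mulrA -exprSr mulr_sumr; apply: eq_big => [a1|a1 /andP[_ lt_a]].
    by rewrite andb_idl // => lt_a; rewrite -(inj_eq val_inj) gtn_eqF.
  by rewrite mulrA -exprD subnKC.
have PM : forall m f, P (g ^+ m * f) -> P f.
  case: P_prime => _ _ PM n f; elim: n => [|n IHn]; first by rewrite mul1r.
  by rewrite exprS -mulrA => /PM[|/IHn].
move: Pc; rewrite def_sum => /PM/PQ QB.
apply: (b_indep (fun t => c (a, t))); rewrite -/(B a) -[B a](addrK (g * rest)).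
apply: is_idealB => //; rewrite mulrC; case: (Q_ideal) => _ _; exact.
Qed.

(** Choose [g i] in [c i.+1] outside [c i]. The [D ^ h] products of powers of the [g i] with
    exponents below [D] are independent modulo [c 0], while their degrees are linear in [D]. Hence
    [D ^ h] is at most a constant times [D ^ N], for every positive [D]. *)
Lemma prime_chain_length_le (c : nat -> R -> Prop) (h : nat) :
  (forall i, (i <= h)%N -> is_prime_ideal (c i)) ->
  (forall i, (i < h)%N -> strict_subideal (c i) (c i.+1)) -> (h <= N)%N.
Proof.
move=> c_prime c_lt.
have /(fun g => constructive_indefinite_description _ (g _)) : 
    forall i, exists g, (i < h)%N -> c i.+1 g /\ ~ c i g.
  move=> i; have [/c_lt [_ [g ?]] | _] := ltnP i h; first by exists g.
  by exists 0.
move=> g0; pose g i := sval (g0 i).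
have gP i : (i < h)%N -> c i.+1 (g i) /\ ~ c i (g i) := svalP (g0 i).
pose s := \max_(i < h) msize (g i).
have g_size i : (i < h)%N -> (msize (g i) <= s)%N.
  by move=> lt_ih; apply: (leq_bigmax (Ordinal lt_ih)).
(* Descending from [c h], where the family is the constant 1: each prime below multiplies the family
   by the powers of one more [g]. *)
have indep D i : (i <= h)%N -> exists (T : finType) (b : T -> R),
    [/\ #|T| = (D ^ i)%N, indep_mod (c (h - i)%N) b
      & forall t, (msize (b t) <= i * D * s.+1 + 1)%N].
  elim: i => [|i IH] le_ih.
    exists unit, (fun _ => 1); rewrite card_unit subn0; split=> //.
      move=> a; rewrite (bigD1 tt) //= big1 ?addr0 => [ch1 []|[] //].
      apply/eqP/contraT => a_neq0; case: (c_prime h (leqnn h)) => -[_ _ cM] c1 _.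
      by case: c1; have := cM (a tt)^-1%:MP _ ch1; rewrite mul_mpolyC scalerA mulVf ?scale1r.
    by move=> _; rewrite msize1.
  have [T [b [cardT b_indep b_size]]] := IH (ltnW le_ih).
  have def_hi : (h - i = (h - i.+1).+1)%N by rewrite subnSK.
  have lt_hi : (h - i.+1 < h)%N by lia.
  have [cg ncg] := gP _ lt_hi; have [c_sub _] := c_lt _ lt_hi; rewrite def_hi in b_indep.
  exists ('I_D * T)%type, (fun x : 'I_D * T => g (h - i.+1)%N ^+ x.1 * b x.2); split.
  - by rewrite card_prod card_ord cardT expnS.
  - apply: indep_mod_adjoin b_indep => //; first by apply: c_prime; lia.
    by case: (c_prime _ lt_hi).
  - move=> [a t] /=; have := b_size t; have := g_size _ lt_hi.
    have: (msize (g (h - i.+1)%N ^+ a * b t) <= a * msize (g (h - i.+1)%N) + msize (b t))%N.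
      elim: (nat_of_ord a) => [|a' IHa]; first by rewrite mul1r.
      rewrite exprS -mulrA; set f := _ ^+ a' * _ in IHa *.
      have [->|g_neq0] := eqVneq (g (h - i.+1)%N) 0; first by rewrite mul0r msize0.
      have [->|f_neq0] := eqVneq f 0; first by rewrite mulr0 msize0.
      by rewrite msizeM // mulSn -addnA; apply: leq_trans (leq_pred _) _; rewrite leq_add2l.
    have := ltn_ord a; nia.
rewrite leqNgt; apply/negP => lt_Nh.
(* All sizes are at most [D * e]. The choice of [D] makes [(D * e) ^ N] smaller than [D ^ N.+1]. *)
pose e := (h * s.+1 + 1)%N; pose D := (e ^ N).+1.
have [T [b [cardT b_indep b_size]]] := indep D h (leqnn h).
rewrite subnn in b_indep.
have: (#|T| <= (D * e) ^ N)%N.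
  apply: (@card_le_of_indep _ _ _ b) => [a sum0|t].
    by apply: b_indep; rewrite sum0; case: (c_prime 0 (leq0n h)) => -[].
  by apply: leq_trans (b_size t) _; rewrite /e /D; nia.
rewrite cardT expnMn leqNgt => /negP; apply.
have -> : (D ^ h = D ^ N * D ^ (h - N))%N by rewrite -expnD subnKC // ltnW.
rewrite ltn_pmul2l ?expn_gt0 //.
by rewrite -(subnSK lt_Nh) expnS; apply: leq_trans (leq_pmulr _ _); rewrite ?expn_gt0.
Qed.

End PrimeChains.

(** * Number of parameters at the origin *)

Section SystemsOfParameters.
Variables (K : fieldType) (N t : nat).
Local Notation R := {mpoly K[N]}.
Variable G : 'I_t -> R.
Hypothesis G0 : forall i, (G i)@_0%MM = 0.
Local Notation IG := (ideal_gen (fun f => exists i, f = G i)).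

(** This is the [j]-th power of the maximal ideal of the origin. *)
Definition vanishing_order_ge (j : nat) (f : R) : Prop :=
  forall m, (mdeg m < j)%N -> f@_m = 0.

Lemma vanishing_order_geM i j f :
  vanishing_order_ge j f -> vanishing_order_ge j.+1 (G i * f).
Proof.
move=> f_van m le_mj; rewrite mcoeffM big1 // => -[k1 k2] /= /eqP def_m.
have [-> | k1_neq0] := eqVneq (k1 : 'X_{1..N}) 0%MM; first by rewrite G0 mul0r.
rewrite f_van ?mulr0 //; have := congr1 mdeg def_m; rewrite mdegD.
by rewrite -mdeg_eq0 in k1_neq0; lia.
Qed.

Variable e : nat.

(* The sum of [(x_1, ..., x_N) ^ j] and of the span of the products of a
   monomial of degree [< e] and of a monomial of degree [< j] in [G]. *)
Inductive spanned (j : nat) : R -> Prop :=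
| spanned_small f of vanishing_order_ge j f : spanned j f
| spanned_add c (mu : 'X_{1..N}) (al : 'X_{1..t}) f of
    (mdeg mu < e)%N & (mdeg al < j)%N & spanned j f :
    spanned j (c *: ('X_[mu] * mmap1 G al) + f).

Lemma spannedD j f g : spanned j f -> spanned j g -> spanned j (f + g).
Proof.
move=> span_f span_g; elim: span_f => {f} [f f_van | c mu al f ? ? _ IH]; last first.
  by rewrite -addrA; apply: spanned_add.
elim: span_g => {g} [g g_van | c mu al g ? ? _ IH]; last first.
  by rewrite addrCA; apply: spanned_add.
by apply: spanned_small => m lt_mj; rewrite mcoeffD f_van ?g_van ?addr0.
Qed.

Lemma spannedZ j c f : spanned j f -> spanned j (c *: f).
Proof.
elim=> {f} [f f_van | d mu al f ? ? _ IH].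
  by apply: spanned_small => m lt_mj; rewrite mcoeffZ f_van ?mulr0.
by rewrite scalerDr scalerA; apply: spanned_add.
Qed.

Lemma spannedM j i f : spanned j f -> spanned j.+1 (G i * f).
Proof.
elim=> {f} [f /(vanishing_order_geM i) f_van | c mu al f lt_mu lt_al _ IH].
  exact: spanned_small.
rewrite mulrDr -scalerAr mulrCA -{1}[G i](mmap1U G) -commr_mmap1_M; last first.
  by move=> *; apply: mulrC.
by apply: spanned_add IH; rewrite // mdegD mdeg1.
Qed.

(** Induction on [j]: a monomial of degree at least [e] is a combination of the [G i] whose
    coefficients are spanned at level [j], and multiplication by [G i] raises the level by one. *)
Lemma spanned_all : (forall m : 'X_{1..N}, (e <= mdeg m)%N -> IG 'X_[m]) ->
  forall j f, spanned j f.
Proof.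
move=> IGm; elim=> [|j IHj] f; first exact: spanned_small.
elim/mpolyind: f => [|c m f _ _ span_f]; first by apply: spanned_small => m _; rewrite mcoeff0.
apply: spannedD span_f; apply: spannedZ.
have [lt_m | /IGm [s [b [g [g_G ->]]]]] := ltnP (mdeg m) e.
  rewrite -['X_[m]]mulr1 -[1](mmap11 G) -[X in spanned _ X]scale1r -[X in spanned _ X]addr0.
  by apply: spanned_add; rewrite ?mdeg0 //; apply: spanned_small => m' _; rewrite mcoeff0.
elim/big_ind: _ => [|? ?|i _]; first by apply: spanned_small => m' _; rewrite mcoeff0.
  exact: spannedD.
by have [i' ->] := g_G i; rewrite mulrC; apply/spannedM/IHj.
Qed.

Definition spanning_family j (s : 'X_{1..N < e} * 'X_{1..t < j}) : R :=
  'X_[s.1 : 'X_{1..N}] * mmap1 G s.2.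

Lemma spanned_family j f : spanned j f ->
  exists c, vanishing_order_ge j (f - \sum_s c s *: @spanning_family j s).
Proof.
elim=> {f} [f f_van | c mu al f lt_mu lt_al _ [c1 IH]].
  by exists (fun _ => 0); rewrite big1 ?subr0 // => s _; rewrite scale0r.
pose s0 := (BMultinom lt_mu, BMultinom lt_al).
exists (fun s => c *+ (s == s0) + c1 s) => m /IH; rewrite mcoeffB => /subr0_eq E.
under [X in _ + f - X]eq_bigr do rewrite scalerDl.
rewrite big_split /= (bigD1 s0) //= eqxx mulr1n [\sum_(s | s != s0) _]big1 ?addr0; last first.
  by move=> s /negPf->; rewrite scale0r.
rewrite -[_ *: ('X_[mu] * _)]/(c *: spanning_family s0) opprD addrACA subrr add0r.
by rewrite mcoeffB E subrr.
Qed.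

End SystemsOfParameters.

(* If the powers of the maximal ideal [m] of the origin eventually lie in
   [(G_1, ..., G_t)], then [R / m ^ j] has dimension [O(j ^ t)]; but this
   dimension grows like [j ^ N]. *)
Lemma parameters_ge (K : fieldType) (N t : nat) (G : 'I_t -> {mpoly K[N]}) :
  (forall i, (G i)@_0%MM = 0) ->
  (forall v : 'I_N, radical (ideal_gen (fun f => exists i, f = G i)) 'X_v) -> (N <= t)%N.
Proof.
set IG := ideal_gen _ => G0 rad_G.
have IG_ideal := ideal_gen_is_ideal (fun f : {mpoly K[N]} => exists i, f = G i).
have {}rad_G v : {d | IG ('X_v ^+ d)} := constructive_indefinite_description _ (rad_G v).
(* A monomial of degree above [N * d] has an exponent above [d], hence is divisible by a power of a
   variable that lies in [IG]. *)
pose d := \max_v sval (rad_G v); pose e := (N * d).+1.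
have IGm (m : 'X_{1..N}) : (e <= mdeg m)%N -> IG 'X_[m].
  move=> lt_m; have [v lt_dv] : exists v, (d < m v)%N.
    apply/existsP; apply: contraLR lt_m => /existsPn m_le.
    rewrite -leqNgt mdegE -[X in (_ <= X * _)%N]card_ord -sum_nat_const.
    by apply: leq_sum => v _; rewrite leqNgt.
  have le_dv : (sval (rad_G v) <= m v)%N by apply: leq_trans (ltnW lt_dv); apply: leq_bigmax.
  case: (IG_ideal) => _ _ IM; rewrite mpolyXE_id (bigD1 v) //= -(subnK le_dv) exprD mulrC.
  by rewrite mulrA; apply: IM; apply: (svalP (rad_G v)).
rewrite leqNgt; apply/negP => lt_tN.
(* Since [j <= N.+1 * q.+1], the spanning family has at most [q * q.+1 ^ t] elements. This is less
   than [q.+1 ^ N], a lower bound for the number of monomials of degree less than [j]. *)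
pose q := (e ^ N * N.+1 ^ t)%N; pose j := (N * q).+1.
have: (#|{: 'X_{1..N < j}}| <= #|{: 'X_{1..N < e} * 'X_{1..t < j}}|)%N.
  apply: (card_le_of_span (w := @spanning_family K N t G e j)) => m lt_mj.
  have [c c_van] := spanned_family (spanned_all G0 IGm j 'X_[m]).
  by exists c => m' /c_van; rewrite mcoeffB => /subr0_eq.
apply/negP; rewrite -ltnNge card_prod.
apply: leq_trans (card_bmultinom_ge N q).
apply: (@leq_ltn_trans (e ^ N * j ^ t)%N); first by apply: leq_mul; apply: card_bmultinom_le.
have le_j : (j <= N.+1 * q.+1)%N by rewrite /j; nia.
apply: (@leq_ltn_trans (e ^ N * (N.+1 * q.+1) ^ t)%N).
  by rewrite leq_mul2l; apply/orP; right; elim: (t) => // t' IHt; rewrite !expnS leq_mul.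
rewrite expnMn mulnA -/q -(subnKC (ltnW lt_tN)) expnD mulnC ltn_pmul2l ?expn_gt0 //.
by rewrite -(subnSK lt_tN) expnS; apply: leq_trans (leq_pmulr _ _); rewrite ?expn_gt0.
Qed.

(** * Chains of kernels *)

Section PrimeChainExtension.
Variable R : comNzRingType.
Implicit Types P Q : R -> Prop.

Lemma prime_chain0 P : is_prime_ideal P -> prime_chain 0 P.
Proof. by move=> P_prime; exists (fun _ => P); split=> // i. Qed.

Lemma prime_chainS h P Q :
  prime_chain h P -> is_prime_ideal Q -> strict_subideal P Q -> prime_chain h.+1 Q.
Proof.
move=> [c [c_prime c_lt cP]] Q_prime [PQ [f [Qf Pf]]].
exists (fun i => if (i <= h)%N then c i else Q); split=> [i _|i|g].
- by case: ifP => // /c_prime.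
- rewrite ltnS => le_ih; rewrite le_ih; case: ltnP => [lt_ih | le_hi]; first exact: c_lt.
  have -> : i = h by apply/eqP; rewrite eqn_leq le_ih.
  by split=> [g /cP/PQ //|]; exists f; split=> // /cP.
- by rewrite ltnn.
Qed.

Lemma prime_chain_widen h P Q :
  prime_chain h P -> is_prime_ideal Q -> subideal P Q ->
  exists2 h', (h <= h')%N & prime_chain h' Q.
Proof.
move=> chP Q_prime PQ.
have [[f PQf] | QP] := excluded_middle_informative (exists f, Q f /\ ~ P f).
  by exists h.+1; rewrite ?leqnSn //; apply: prime_chainS chP _ _ => //; split=> //; exists f.
exists h => //; case: chP => c [c_prime c_lt cP]; exists c; split=> // f.
split=> [/cP/PQ // | Qf]; apply/cP; case: (excluded_middle_informative (P f)) => // Pf.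
by case: QP; exists f.
Qed.

(** The bottom [h - m] primes are dropped, so that the chain still ends at [P]. *)
Lemma prime_chain_take m h P : (m <= h)%N -> prime_chain h P ->  prime_chain m P.
Proof.
move=> le_mh [c [c_prime c_lt cP]].
exists (fun i => c (i + (h - m))%N); split=> [i le_im|i lt_im|f].
- by apply: c_prime; lia.
- by apply: c_lt; lia.
- by rewrite subnKC.
Qed.

End PrimeChainExtension.

Lemma mpoly_rmorph_eq (K : nzRingType) (N : nat) (S : comNzRingType)
    (phi psi : {rmorphism {mpoly K[N]} -> S}) :
  (forall c, phi c%:MP = psi c%:MP) -> (forall i, phi 'X_i = psi 'X_i) -> phi =1 psi.
Proof.
move=> eqC eqX f; rewrite [f]mpolyE !rmorph_sum /=; apply: eq_bigr => m _.
rewrite -mul_mpolyC !rmorphM eqC; congr (_ * _).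
rewrite mpolyXE_id !rmorph_prod; apply: eq_bigr => i _.
by rewrite !rmorphXn /= eqX.
Qed.

Section Substitutions.
Variables (K : fieldType) (N : nat).
Local Notation R := {mpoly K[N]}.

Definition substitution (h : 'I_N -> R) : R -> R := mmap (@mpolyC N K) h.
HB.instance Definition _ h := GRing.RMorphism.on (substitution h).

Lemma substitutionX h v : substitution h 'X_v = h v.
Proof. by rewrite /substitution mmapX mmap1U. Qed.

Definition kill (v : 'I_N) : {rmorphism R -> R} :=
  substitution (fun w => if w == v then 0 else 'X_w).

Lemma killX v w : kill v 'X_w = if w == v then 0 else 'X_w.
Proof. exact: substitutionX. Qed.

Lemma mpolyX_neq0 (m : 'X_{1..N}) : 'X_[m] != 0 :> R.
Proof. by rewrite -msize_poly_eq0 msizeX. Qed.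

(** Primes are represented as kernels of endomorphisms of [R]. Composing with [psi] enlarges the
    kernel, and [g] witnesses that it does so strictly. *)
Lemma prime_chain_comp (h : nat) (sigma psi : {rmorphism R -> R}) (g : R) :
  prime_chain h (fun f => sigma f = 0) -> sigma g != 0 -> psi (sigma g) = 0 ->
  prime_chain h.+1 (fun f => psi (sigma f) = 0).
Proof.
move=> ch_sigma sg psg; apply: prime_chainS ch_sigma (ker_is_prime (psi \o sigma)) _.
split=> [f|]; first by move=> /= ->; apply: rmorph0.
by exists g; split=> //; apply/eqP.
Qed.

(* [theta] factors through [sigma], whose kernel is at the top of a chain of
   length [h], and the variables outside [A] are still free in its image. *)
Definition factors_through_chain (L : comNzRingType) (theta : {rmorphism R -> L})
    (h : nat) (A : {set 'I_N}) : Prop :=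
  exists (sigma : {rmorphism R -> R}) (theta' : {rmorphism R -> L}),
    [/\ prime_chain h (fun f => sigma f = 0),
        forall f, theta f = theta' (sigma f)
      & forall v, v \notin A -> sigma 'X_v = 'X_v].

(** Only the constants keep their images under [theta]; the variables get new values, as needed when
    a variable is recycled. *)
Definition extension (L : comNzRingType) (theta : {rmorphism R -> L}) (l : 'I_N -> L) :
    {rmorphism R -> L} :=
  mmap (theta \o @mpolyC N K) l.

Lemma extensionX (L : comNzRingType) (theta : {rmorphism R -> L}) l v :
  extension theta l 'X_v = l v.
Proof. by rewrite /extension /= mmapX mmap1U. Qed.

(** Common pattern of the two ways to lengthen the chain: [s] kills the new element [sigma g], and
    the values [l] are such that [extension theta' l] after [s] is again [theta']. *)
Lemma factors_through_chain_step (L : comNzRingType) (theta : {rmorphism R -> L})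
    (h : nat) (A B : {set 'I_N}) :
  factors_through_chain theta h A -> A \subset B ->
  (forall (sigma : {rmorphism R -> R}) (theta' : {rmorphism R -> L}),
    (forall f, theta f = theta' (sigma f)) ->
    (forall v, v \notin A -> sigma 'X_v = 'X_v) ->
    exists (s : 'I_N -> R) (l : 'I_N -> L) (g : R),
    [/\ sigma g != 0, substitution s (sigma g) = 0,
        forall v, extension theta' l (s v) = theta' 'X_v
      & forall v, v \notin B -> s v = 'X_v]) ->
  factors_through_chain theta h.+1 B.
Proof.
move=> [sigma [theta' [ch_sigma fact sigmaX]]] sAB /(_ sigma theta' fact sigmaX).
move=> [s [l [g [sg0 ssg sl sX]]]].
exists (substitution s \o sigma), (extension theta' l); split.
- exact: (prime_chain_comp (psi := substitution s)) ch_sigma sg0 ssg.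
- move=> f; rewrite fact /=; move: (sigma f).
  apply: (@mpoly_rmorph_eq _ _ _ theta' (extension theta' l \o substitution s)) => [c|v] /=.
    by rewrite /substitution /extension !mmapC.
  by rewrite substitutionX sl.
- move=> v vB; rewrite /= sigmaX ?substitutionX ?sX //.
  by apply: contraNN vB; apply: (subsetP sAB).
Qed.

Lemma factors_through_chain_zero (L : comNzRingType) (theta : {rmorphism R -> L})
    (h : nat) (A : {set 'I_N}) v :
  factors_through_chain theta h A -> v \notin A -> theta 'X_v = 0 ->
  factors_through_chain theta h.+1 (v |: A).
Proof.
move=> fact_A vA theta_v; apply: factors_through_chain_step fact_A (subsetUr _ _) _.
move=> sigma theta' fact sigmaX.
exists (fun w => if w == v then 0 else 'X_w), (fun w => theta' 'X_w), 'X_v.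
rewrite sigmaX ?mpolyX_neq0 // substitutionX eqxx; split=> // w.
  case: eqP => [->|_]; last exact: extensionX.
  by rewrite rmorph0 -[in RHS](sigmaX v) // -fact.
by rewrite !inE => /norP[/negPf->].
Qed.

(* The vector [(X_v, X_v')] becomes a multiple of [(X_r, X_r')], with [X_v]
   recycled as the coefficient. *)
Lemma factors_through_chain_prop (L : fieldType) (theta : {rmorphism R -> L})
    (h : nat) (A : {set 'I_N}) (r r' v v' : 'I_N) :
  factors_through_chain theta h A -> uniq [:: r; r'; v; v'] ->
  [/\ r \notin A, r' \notin A, v \notin A & v' \notin A] ->
  (theta 'X_r != 0) || (theta 'X_r' != 0) ->
  theta 'X_r * theta 'X_v' = theta 'X_v * theta 'X_r' ->
  factors_through_chain theta h.+1 (v |: (v' |: A)).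
Proof.
move=> fact_A; rewrite /= !inE !negb_or !andbT => /and3P[/and3P[rr' rv rv'] /andP[r'v r'v'] vv'].
move=> [rA r'A vA v'A] theta_r0 theta_det.
apply: factors_through_chain_step fact_A _ _.
  by rewrite setUA; apply: subsetUr.
move=> sigma theta' fact sigmaX.
have theta'X w : w \notin A -> theta' 'X_w = theta 'X_w by move=> wA; rewrite fact sigmaX.
(* The factor of proportionality is the quotient at a nonzero coordinate of the vector at [r]; the
   vanishing determinant settles the other coordinate. *)
have [t [tr tr']] : exists t, t * theta 'X_r = theta 'X_v /\ t * theta 'X_r' = theta 'X_v'.
  case/orP: theta_r0 => [r0|r'0].
    exists (theta 'X_v / theta 'X_r); rewrite divfK //; split=> //.
    by rewrite mulrAC -theta_det mulrC mulKf.
  exists (theta 'X_v' / theta 'X_r'); rewrite divfK //; split=> //.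
  by rewrite mulrAC [_ * theta 'X_r]mulrC theta_det mulfK.
pose s w : R := if w == v then 'X_v * 'X_r else if w == v' then 'X_v * 'X_r' else 'X_w.
exists s, (fun w => if w == v then t else theta' 'X_w), ('X_r * 'X_v' - 'X_v * 'X_r').
have sr w : w \in [:: r; r'] -> s w = 'X_w.
  rewrite /s !inE; case/orP => /eqP ->; first by rewrite (negPf rv) (negPf rv').
  by rewrite (negPf r'v) (negPf r'v').
have sv' : s v' = 'X_v * 'X_r' by rewrite /s eq_sym (negPf vv') eqxx.
have sv : s v = 'X_v * 'X_r by rewrite /s eqxx.
have -> : sigma ('X_r * 'X_v' - 'X_v * 'X_r') = 'X_r * 'X_v' - 'X_v * 'X_r'.
  by rewrite rmorphB !rmorphM !sigmaX.
split.
(* Setting [X_v] to zero leaves the nonzero monomial [X_r * X_v']. *)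
- apply/eqP => /(congr1 (kill v)); rewrite rmorphB !rmorphM !killX eqxx mul0r subr0 rmorph0.
  rewrite (negPf rv) eq_sym (negPf vv') => /eqP.
  by rewrite mulf_eq0 !(negPf (mpolyX_neq0 _)).
- rewrite rmorphB !rmorphM /= !substitutionX sv sv' !sr ?inE ?eqxx ?orbT //.
  by rewrite mulrCA mulrA subrr.
- move=> w; have [->|wv] := eqVneq w v.
    by rewrite sv rmorphM !extensionX eqxx (negPf rv) !theta'X.
  have [->|wv'] := eqVneq w v'.
    by rewrite sv' rmorphM !extensionX eqxx (negPf r'v) !theta'X.
  by rewrite /s (negPf wv) (negPf wv') extensionX (negPf wv).
- by move=> w; rewrite !inE /s => /norP[/negPf-> /norP[/negPf->]].
Qed.

End Substitutions.

(** * Ideals containing the binomials of a Hamiltonian path *)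

Section HamiltonianPath.
Variables (K : fieldType) (n : nat) (eta : nat -> 'I_n).
Hypothesis eta_inj : forall i j, (i < n)%N -> (j < n)%N -> eta i = eta j -> i = j.
Hypothesis eta_surj : forall v, exists2 i, (i < n)%N & v = eta i.
Local Notation R := {mpoly K[n + n]}.
Local Notation x i := (lshift n (eta i)).
Local Notation y i := (rshift n (eta i)).

Lemma prime_chain_path_ideal (Q : R -> Prop) :
  is_prime_ideal Q -> (forall i, (i.+1 < n)%N -> Q (edge_binomial K (eta i) (eta i.+1))) ->
  prime_chain n.-1 Q.
Proof.
move=> Q_prime Q_path; have [L [theta theta_ker]] := prime_is_kernel Q_prime.
pose X i := theta 'X_(x i); pose Y i := theta 'X_(y i).
have XY i : (i.+1 < n)%N -> X i * Y i.+1 = X i.+1 * Y i.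
  by move=> /Q_path/theta_ker; rewrite rmorphB !rmorphM => /eqP; rewrite subr_eq0 => /eqP.
have lr i j : (lshift n (eta i) == rshift n (eta j)) = false by apply: eq_lrshift.
have rl i j : (rshift n (eta i) == lshift n (eta j)) = false by apply: eq_rlshift.
have eta_eq i j : (i < n)%N -> (j < n)%N -> (eta i == eta j) = (i == j).
  by move=> lt_in lt_jn; apply/eqP/eqP => [/eta_inj-> //|->].
(* Invariant after [j] vertices: either at least [j] steps are made, or at most one is missing and
   vertex [j.-1] lies in a run of nonzero vectors. In the latter case its vector is proportional to
   the one at the start [r] of the run, whose variables are still free. *)
have main j : (j <= n)%N -> exists h A, [/\ factors_through_chain theta h A,
    forall i, (j <= i < n)%N -> (x i \notin A) && (y i \notin A) &
    (j <= h)%N \/ exists2 r, (r < j)%N &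
      [/\ (j <= h.+1)%N, (x r \notin A) && (y r \notin A),
          (X j.-1 != 0) || (Y j.-1 != 0), (X r != 0) || (Y r != 0)
        & X r * Y j.-1 = X j.-1 * Y r]].
  elim: j => [_|j IHj lt_jn].
    exists 0%N, set0; split=> [|i _|]; rewrite ?inE //; last by left.
    exists idfun, theta; split=> //.
    have Q0 := ker_is_prime (idfun : {rmorphism R -> R}); exact: prime_chain0.
  have [h [A [fact_A A_free hj]]] := IHj (ltnW lt_jn).
  have /andP[xA yA] : (x j \notin A) && (y j \notin A) by apply: A_free; rewrite leqnn.
  have free_U i : (j < i < n)%N ->
      (x i \notin x j |: (y j |: A)) && (y i \notin x j |: (y j |: A)).
    move=> /andP[lt_ji lt_in];
    rewrite !inE !negb_or (inj_eq (@lshift_inj n n)) (inj_eq (@rshift_inj n n)) lr rl.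
    by rewrite eta_eq // (gtn_eqF lt_ji) A_free // (ltnW lt_ji).
  have [/andP[/eqP Xj /eqP Yj] | XYj] := boolP ((X j == 0) && (Y j == 0)).
    exists h.+2, (x j |: (y j |: A)); split=> //; last by left; case: hj => [|[r _ [?]]]; lia.
    apply: factors_through_chain_zero => //; last by rewrite !inE lr.
    exact: factors_through_chain_zero.
  rewrite negb_and in XYj; case: hj => [le_jh | [r lt_rj [le_jh /andP[xrA yrA] XYj1 XYr det_r]]].
    exists h, A; split=> //; first by move=> i /andP[lt_ji lt_in]; apply: A_free; rewrite ltnW.
    by right; exists j => //; split; rewrite ?xA ?yA.
  (* Proportionality is transitive here because the middle vector, at [j.-1], is nonzero: one of its
     coordinates can be cancelled. *)
  have det_rj : X r * Y j = X j * Y r.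
    have := XY j.-1; rewrite prednK ?(leq_ltn_trans _ lt_rj) // => /(_ lt_jn) det_j.
    case/orP: XYj1 => nz; apply: (mulfI nz).
      transitivity (X r * (X j.-1 * Y j)); first by ring.
      transitivity (X j * (X r * Y j.-1)); first by rewrite det_j; ring.
      by rewrite det_r; ring.
    transitivity ((X r * Y j.-1) * Y j); first by ring.
    transitivity ((X j.-1 * Y j) * Y r); first by rewrite det_r; ring.
    by rewrite det_j; ring.
  have rj : (eta r == eta j) = false by rewrite eta_eq ?(ltn_eqF lt_rj) // (ltn_trans lt_rj).
  exists h.+1, (x j |: (y j |: A)); split=> //.
    apply: (factors_through_chain_prop (r := x r) (r' := y r)) => //.
    rewrite /= !inE !negb_or !lr !rl (inj_eq (@lshift_inj n n)) (inj_eq (@rshift_inj n n)).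
    by rewrite rj.
  right; exists r; first exact: ltnW.
  rewrite !inE !negb_or (inj_eq (@lshift_inj n n)) (inj_eq (@rshift_inj n n)) lr rl.
  by rewrite rj xrA yrA.
have [h [A [[sigma [theta' [ch_sigma fact _]]] _ hn]]] := main n (leqnn n).
have [|h' le_hh' ch_Q] := prime_chain_widen ch_sigma Q_prime.
  by move=> f sf0; apply/theta_ker; rewrite fact sf0 rmorph0.
by apply: prime_chain_take ch_Q; case: hn => [|[r _ [?]]]; lia.
Qed.

(** The substitution [y_i := x_i * T] parametrizes matrices of rank at most 1, with [T] one of the
    [y] variables recycled. Killing [T] and then the [x_i] one by one adds [n + 1] steps above its
    kernel, and no chain is longer than [n + n]. *)
Lemma prime_generic_rank1 : (0 < n)%N -> exists P : R -> Prop,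
  [/\ is_prime_ideal P, forall i j, P (edge_binomial K i j)
    & forall h, prime_chain h P -> (h <= n.-1)%N].
Proof.
move=> n_gt0; pose i0 := eta 0; pose T : R := 'X_(rshift n i0).
pose s v : R := match split v with inl i => 'X_(lshift n i) | inr i => 'X_(lshift n i) * T end.
pose phi : {rmorphism R -> R} := substitution s.
have phil i : phi 'X_(lshift n i) = 'X_(lshift n i).
  by rewrite /= substitutionX /s (unsplitK (inl _ i)).
have phir i : phi 'X_(rshift n i) = 'X_(lshift n i) * T.
  by rewrite /= substitutionX /s (unsplitK (inr _ i)).
have phiT : phi T = 'X_(lshift n i0) * T := phir i0.
exists (fun f => phi f = 0); split=> [|i j|h ch_phi]; first exact: ker_is_prime.
  by rewrite rmorphB !rmorphM !phil !phir mulrCA subrr.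
have main j : (j <= n)%N -> exists sigma : {rmorphism R -> R},
    prime_chain (h.+1 + j) (fun f => sigma f = 0) /\
    forall i, (j <= i < n)%N -> sigma 'X_(x i) = 'X_(x i).
  elim: j => [_|j IHj lt_jn].
    rewrite addn0; exists (kill _ (rshift n i0) \o phi); split.
      apply: (prime_chain_comp (g := T)) ch_phi _ _.
        by rewrite phiT mulf_neq0 ?mpolyX_neq0.
      have killT : kill K (rshift n i0) T = 0 by rewrite killX eqxx.
      by rewrite phiT rmorphM killT mulr0.
    by move=> i _; rewrite [LHS](congr1 (kill _ _) (phil _)) killX eq_lrshift.
  have [sigma [ch_sigma sigmaX]] := IHj (ltnW lt_jn).
  have sigmaXj : sigma 'X_(x j) = 'X_(x j) by apply: sigmaX; rewrite leqnn.
  exists (kill _ (x j) \o sigma); split.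
    rewrite addnS; apply: (prime_chain_comp (g := 'X_(x j))) ch_sigma _ _.
      by rewrite sigmaXj mpolyX_neq0.
    by rewrite sigmaXj killX eqxx.
  move=> i /andP[lt_ji lt_in]; have le_jin : (j <= i < n)%N by rewrite ltnW.
  rewrite [LHS](congr1 (kill _ _) (sigmaX i le_jin)) killX ifN //.
  rewrite (inj_eq (@lshift_inj n n)); apply: contraTneq lt_ji => /eta_inj-> //.
  by rewrite ltnn.
have [sigma [[c [c_prime c_lt _]] _]] := main n (leqnn n).
by have := prime_chain_length_le c_prime c_lt; lia.
Qed.

(** The last hypothesis places [J] inside the ideal of all 2-minors. The path binomials bound the
    height from below, the generic rank 1 prime from above. *)
Lemma height_path_ideal (J : R -> Prop) :
  (0 < n)%N -> (forall i, (i.+1 < n)%N -> J (edge_binomial K (eta i) (eta i.+1))) ->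
  (forall I, is_ideal I -> (forall i j, I (edge_binomial K i j)) -> subideal J I) ->
  height J n.-1.
Proof.
move=> n_gt0 J_path J_edges; split.
  have [P [P_prime PE P_le]] := prime_generic_rank1 n_gt0.
  have JP : subideal J P by apply: J_edges => //; case: P_prime.
  by exists P; split=> //; split=> //; apply: prime_chain_path_ideal.
move=> Q m Q_prime JQ [_ Q_le]; apply/Q_le/prime_chain_path_ideal => // i lt_in.
exact/JQ/J_path.
Qed.

Lemma arithmetical_rank_path_ideal_ge (J : R -> Prop) (t : nat) :
  (forall i, (i.+1 < n)%N -> J (edge_binomial K (eta i) (eta i.+1))) ->
  (forall I, is_ideal I -> (forall i j, I (edge_binomial K i j)) -> subideal J I) ->
  cut_out_by J t -> (n.-1 <= t)%N.
Proof.
move=> J_path J_edges [F [JF radF]].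
(* For positive [n] these are [x_0], the [x_j - y_(j-1)] and [- y_(n-1)]. Once all variables are in
   the radical, [n + n <= t + n.+1]. *)
pose ell (j : 'I_n.+1) : R :=
  (if (j < n)%N then 'X_(x j) else 0) - (if (0 < j)%N then 'X_(y j.-1) else 0).
pose G (i : 'I_(t + n.+1)) := match split i with inl i => F i | inr j => ell j end.
have constX (v : 'I_(n + n)) : ('X_v : R)@_0%MM = 0 by rewrite mcoeffX mnm1_eq0.
have J0 : subideal J (fun f => f@_0%MM = 0).
  apply: J_edges => [|i j]; last by rewrite mcoeffB !rmorphM /= !constX !mul0r subrr.
  split=> [|g g' Eg Eg'|a g Eg]; first exact: mcoeff0.
    by rewrite mcoeffD Eg Eg' addr0.
  by rewrite rmorphM /= Eg mulr0.
have G0 i : (G i)@_0%MM = 0.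
  rewrite /G; case: split => [k|j]; first exact/J0/JF.
  by rewrite mcoeffB; case: ifP; case: ifP; rewrite ?constX ?mcoeff0 subrr.
set IG := ideal_gen (fun f => exists i, f = G i).
suff radX v : radical IG 'X_v by have := parameters_ge G0 radX; lia.
have IG_rad : is_ideal (radical IG) by apply/radical_is_ideal/ideal_gen_is_ideal.
have [rad0 radD radM] := IG_rad.
have rad_ell j : radical IG (ell j).
  apply/sub_radical/mem_ideal_gen; exists (rshift t j).
  by rewrite /G (unsplitK (inr _ j)).
have radJ f : J f -> radical IG f.
  move=> Jf; have : radical (ideal_gen (fun g => exists i, g = F i)) f.
    exact/radF/sub_radical.
  apply: radical_sub; apply: (ideal_gen_min IG_rad) => _ [i ->].
  apply/sub_radical/mem_ideal_gen; exists (lshift n.+1 i).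
  by rewrite /G (unsplitK (inl _ i)).
(* Modulo the linear forms, the binomial of the edge from [j] to [j.+1] is
   [x_j * y_(j+1) - x_(j+1) ^ 2], so membership in the radical propagates along the path. *)
have rad_x j : (j < n)%N -> radical IG 'X_(x j).
  elim: j => [|j IHj] lt_jn.
    by have := rad_ell ord0; rewrite /ell /= lt_jn subr0.
  have lt_jSn : (j.+1 < n.+1)%N by apply: ltnW.
  have rad_e : radical IG ('X_(x j.+1) - 'X_(y j)).
    by have := rad_ell (Ordinal lt_jSn); rewrite /ell /= lt_jn.
  have rad_f : radical IG ('X_(x j) * 'X_(y j.+1) - 'X_(x j.+1) * 'X_(y j)).
    exact/radJ/J_path.
  apply: (@radical_idem _ _ _ 2).
  have -> : 'X_(x j.+1) ^+ 2 = 'X_(x j.+1) * ('X_(x j.+1) - 'X_(y j)) +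
     ('X_(y j.+1) * 'X_(x j) - ('X_(x j) * 'X_(y j.+1) - 'X_(x j.+1) * 'X_(y j))) :> R.
    by ring.
  refine (radD _ _ (radM _ _ rad_e) _).
  by apply: (is_idealB IG_rad); [apply/radM/IHj/ltnW | exact: rad_f].
have rad_y j : (j < n)%N -> radical IG 'X_(y j).
  move=> lt_jn; have := rad_ell (Ordinal (lt_jn : j.+1 < n.+1)%N); rewrite /ell /=.
  case: ifP => [lt_jSn | _] rad_e; last first.
    by rewrite -[X in radical IG X]opprK -[- 'X_(y j)]add0r; apply: is_idealN.
  have -> : 'X_(y j) = 'X_(x j.+1) - ('X_(x j.+1) - 'X_(y j)) :> R by ring.
  by apply: (is_idealB IG_rad); [exact: rad_x | exact: rad_e].
case: (splitP v) => i def_v; have [j lt_jn def_i] := eta_surj i.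
  by have -> : v = x j; [apply/val_inj; rewrite /= def_v def_i | apply: rad_x].
by have -> : v = y j; [apply/val_inj; rewrite /= def_v def_i | apply: rad_y].
Qed.

End HamiltonianPath.

Local Close Scope ring_scope.

(** * The Hamiltonian path of a chain of triangles *)

Section Triangles.
Variable T : finType.
Implicit Types (e : rel T) (c : seq T).

Lemma triangle_adj e c u v : ssrbool.symmetric e -> cycle_of_length e 3 c ->
  u \in c -> v \in c -> u != v -> e u v.
Proof.
move=> e_sym [/andP[e_c _]].
case: c e_c => [|x [|y [|z [|]]]] //= /and4P[exy eyz ezx _] _.
rewrite !inE => /or3P[] /eqP-> /or3P[] /eqP->; rewrite ?eqxx // => _ //; by rewrite e_sym.
Qed.

Lemma third_vertex c u w : uniq c -> size c = 3 -> u \in c -> w \in c -> u != w ->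
  exists z, uniq [:: u; z; w] /\ c =i [:: u; z; w].
Proof.
move=> c_uniq c_size uc wc uw.
have: has (fun z => z \notin [:: u; w]) c.
  apply: contraT => /hasPn c_sub; have: size c <= size [:: u; w].
    by apply: uniq_leq_size => // x /c_sub; rewrite negbK.
  by rewrite c_size.
case/hasP=> z zc; rewrite !inE negb_or => /andP[zu zw].
have uzw : uniq [:: u; z; w] by rewrite /= !inE negb_or [u == z]eq_sym zu zw uw.
have sub : {subset [:: u; z; w] <= c} by move=> x; rewrite !inE => /or3P[] /eqP->.
have [|_ eq_c] := uniq_min_size uzw sub; first by rewrite c_size.
by exists z; split=> // x; rewrite eq_c.
Qed.

Lemma second_vertex c u : uniq c -> size c = 3 -> exists2 w, w \in c & u != w.
Proof.
move=> c_uniq c_size.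
have: has (fun w => u != w) c.
  apply: contraT => /hasPn c_sub; have: size c <= size [:: u].
    by apply: uniq_leq_size => // x /c_sub; rewrite negbK inE eq_sym.
  by rewrite c_size.
by case/hasP=> w; exists w.
Qed.

End Triangles.

Section TriangleChain.
Variables (n : nat) (e : rel 'I_n) (k : nat) (r : nat -> nat).
Variables (C : nat -> seq 'I_n) (a : nat -> 'I_n) (p : nat -> seq 'I_n).
Hypothesis e_graph : connected_simple_graph e.
Hypothesis k_gt1 : 2 <= k.
Hypothesis r_gt1 : forall i, i < k.-1 -> 2 <= r i.
Hypothesis hG : triangle_chain e k r C a p.

Let e_sym : ssrbool.symmetric e. Proof. by case: e_graph. Qed.

(** The chain enters the [i]-th triangle at [u i] and leaves it at [w i]. The entrance of the first
    triangle and the exit of the last are not prescribed. *)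
Definition triangle_labelling (u z w : nat -> 'I_n) : Prop :=
  [/\ forall i, i < k -> uniq [:: u i; z i; w i],
      forall i, i < k -> C i =i [:: u i; z i; w i],
      forall i, i < k.-1 -> w i = a i
    & forall i, i < k.-1 -> u i.+1 = last (a i) (p i)].

(** In a middle triangle, entrance and exit differ because consecutive paths are disjoint; in the
    two extreme triangles, any second vertex serves. *)
Lemma triangle_labelling_exists : exists u z w, triangle_labelling u z w.
Proof.
have lab i : exists t : 'I_n * 'I_n * 'I_n, i < k ->
    [/\ uniq [:: t.1.1; t.1.2; t.2], C i =i [:: t.1.1; t.1.2; t.2],
        i < k.-1 -> t.2 = a i
      & forall j, i = j.+1 -> t.1.1 = last (a j) (p j)].
  have [lt_ik | _] := ltnP i k; last by exists (a 0, a 0, a 0).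
  have [/andP[_ Ci_uniq] Ci_size] := tc_cycle hG lt_ik.
  suff [u [w [uC wC uw hw hu]]] : exists u w, [/\ u \in C i, w \in C i, u != w,
      i < k.-1 -> w = a i & forall j, i = j.+1 -> u = last (a j) (p j)].
    by have [z [? ?]] := third_vertex Ci_uniq Ci_size uC wC uw; exists (u, z, w).
  case: i lt_ik Ci_uniq Ci_size => [|i] lt_ik Ci_uniq Ci_size.
    have lt_0 : 0 < k.-1 by lia.
    have [[_ _ aC _ _] _] := tc_path hG lt_0.
    have [u uC au] := second_vertex (a 0) Ci_uniq Ci_size.
    by exists u, (a 0); split; rewrite // eq_sym.
  have lt_ik1 : i < k.-1 by lia.
  have [[_ _ _ lC _] _] := tc_path hG lt_ik1.
  have [lt_iSk | le_k] := ltnP i.+1 k.-1; last first.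
    have [w wC lw] := second_vertex (last (a i) (p i)) Ci_uniq Ci_size.
    exists (last (a i) (p i)), w; split=> // j.
    by case=> ->.
  have [[_ _ aC _ _] _] := tc_path hG lt_iSk.
  exists (last (a i) (p i)), (a i.+1); split=> //; last by move=> j [->].
  have dis : [disjoint a i :: p i & a i.+1 :: p i.+1].
    by apply: (tc_path_disjoint hG); rewrite ltnSn.
  by apply: contraTneq (mem_last (a i) (p i)) => ->; rewrite (disjointFl dis) ?mem_head.
pose t i := constructive_indefinite_description _ (lab i).
exists (fun i => (sval (t i)).1.1), (fun i => (sval (t i)).1.2), (fun i => (sval (t i)).2).
split=> i lt_ik.
- by have [] := svalP (t i) lt_ik.
- by have [] := svalP (t i) lt_ik.
- by have [|_ _ -> //] := svalP (t i); lia.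
- have lt_iSk : i.+1 < k by lia.
  by have [_ _ _] := svalP (t i.+1) lt_iSk; apply.
Qed.

Section Labelled.
Variables (u z w : nat -> 'I_n).
Hypothesis lab : triangle_labelling u z w.

Let mem_u i : i < k -> u i \in C i.
Proof. by move=> lt_ik; case: lab => _ -> //; rewrite !inE eqxx. Qed.
Let mem_z i : i < k -> z i \in C i.
Proof. by move=> lt_ik; case: lab => _ -> //; rewrite !inE eqxx orbT. Qed.
Let mem_w i : i < k -> w i \in C i.
Proof. by move=> lt_ik; case: lab => _ -> //; rewrite !inE eqxx !orbT. Qed.

(** The interior vertices of the connecting path. *)
Let inner i := behead (belast (a i) (p i)).

Let C_disjoint i j v : i < k -> j < k -> v \in C i -> v \in C j -> i = j.
Proof.
move=> lt_ik lt_jk vi vj; have [lt_ij | lt_ji | //] := ltngtP i j.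
  by rewrite (disjointFr (tc_cycle_disjoint hG (_ : i < j < k)) vi) ?lt_ij in vj.
by rewrite (disjointFr (tc_cycle_disjoint hG (_ : j < i < k)) vj) ?lt_ji in vi.
Qed.

Let inner_C i j v : i < k.-1 -> j < k -> v \in inner i -> v \notin C j.
Proof. by move=> lt_i lt_jk; have [[_ _ _ _ inC] _] := tc_path hG lt_i; apply: inC. Qed.

Let sub_inner i : {subset inner i <= p i}.
Proof.
rewrite /inner; case: (p i) => //= y s x; rewrite lastI mem_rcons inE => ->.
exact: orbT.
Qed.

Let mem_path i v : i < k.-1 -> v \in p i -> v \in inner i \/ v = u i.+1.
Proof.
move=> lt_ik; case: lab => _ _ _ -> //; rewrite /inner; case: (p i) => //= y s.
by rewrite lastI mem_rcons inE => /predU1P[->|]; [right|left].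
Qed.

Let mem_exit i : i < k.-1 -> u i.+1 \in p i.
Proof.
move=> lt_ik; case: lab => _ _ _ -> //; have [_] := tc_path hG lt_ik.
by case: (p i) (r_gt1 lt_ik) => [|y s] //=; [case: (r i) | rewrite mem_last].
Qed.

Let inner_disjoint i j v : i < j < k.-1 -> v \in inner i -> v \notin inner j.
Proof.
move=> lt_ijk /sub_inner vi; apply/negP => /sub_inner vj.
have := disjointFr (tc_path_disjoint hG lt_ijk) (_ : v \in a i :: p i).
by rewrite !inE vi vj !orbT => /(_ isT).
Qed.

(** The entrance [u i] is left out, since it already ends the preceding block, and the path brings
    in the next entrance. Thus [ham m] ends at [u m] for [m <= k.-1]. *)
Definition block i := z i :: w i :: (if i < k.-1 then p i else [::]).
Definition ham m := u 0 :: flatten [seq block i | i <- iota 0 m].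

Lemma hamS m : ham m.+1 = ham m ++ block m.
Proof. by rewrite /ham -addn1 iotaD map_cat flatten_cat /= cats0. Qed.

Lemma size_ham m : m <= k.-1 -> size (ham m) = (2 * m + \sum_(i < m) r i).+1.
Proof.
elim: m => [|m IHm] lt_mk; first by rewrite big_ord0.
rewrite hamS size_cat IHm ?(ltnW lt_mk) // big_ord_recr /block lt_mk /=.
by have [_ ->] := tc_path hG lt_mk; lia.
Qed.

Let adj i v v' : i < k -> v \in C i -> v' \in C i -> v != v' -> e v v'.
Proof. by move=> lt_ik; apply: triangle_adj (tc_cycle hG lt_ik). Qed.

Let adj_uz i : i < k -> e (u i) (z i) && e (z i) (w i).
Proof.
move=> lt_ik; case: lab => /(_ i lt_ik) + _ _ _.
rewrite /= !inE negb_or andbT => /andP[/andP[uz _] zw].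
by rewrite !(adj lt_ik) ?mem_u ?mem_z ?mem_w.
Qed.

Lemma ham_path m : m <= k -> path e (u 0) (behead (ham m)).
Proof.
have ham_path_last j : j <= k.-1 ->
    path e (u 0) (behead (ham j)) /\ last (u 0) (behead (ham j)) = u j.
  elim: j => [//|j IHj] lt_jk; have [ham_e ham_last] := IHj (ltnW lt_jk).
  have [[p_e _ _ _ _] _] := tc_path hG lt_jk; case: (lab) => _ _ wa ul.
  have /adj_uz /andP[euz ezw] : j < k by lia.
  rewrite hamS /= cat_path last_cat ham_e ham_last /block lt_jk /= euz ezw.
  by rewrite wa // p_e ul.
rewrite leq_eqVlt => /predU1P[-> | lt_mk]; last by have [] := ham_path_last m; lia.
have def_k : k = k.-1.+1 by lia.
have [ham_e ham_last] := ham_path_last _ (leqnn k.-1).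
have /adj_uz /andP[euz ezw] : k.-1 < k by lia.
by rewrite def_k hamS /= cat_path ham_e ham_last /block ltnn /= euz ezw.
Qed.

Lemma mem_block m v : m < k -> v \in block m ->
  [\/ v \in C m /\ v != u m, m < k.-1 /\ v \in inner m | m < k.-1 /\ v = u m.+1].
Proof.
move=> lt_mk; case: (lab) => /(_ m lt_mk) + _ _ _.
rewrite /= !inE negb_or andbT => /andP[/andP[uz uw] zw].
case/or3P=> [/eqP->|/eqP->|].
- by constructor 1; rewrite eq_sym uz mem_z.
- by constructor 1; rewrite eq_sym uw mem_w.
- case: ifP => // lt_mk1 /(mem_path lt_mk1) [vp|->]; [by constructor 2 | by constructor 3].
Qed.

Lemma mem_ham m v : m < k -> v \in ham m ->
  [\/ exists2 i, i < m & v \in C i, exists2 i, i < m & v \in inner i | v = u m].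
Proof.
elim: m => [_|m IHm lt_mk]; first by rewrite inE => /eqP->; constructor 3.
have lt_mk' := ltnW lt_mk.
rewrite hamS mem_cat.
case/orP=> [/(IHm lt_mk')[[i lt_im vi] | [i lt_im vi] | ->] |
            /(mem_block lt_mk')[[vm _] | [_ vm] | [_ ->]]].
- by constructor 1; exists i; rewrite // ltnS ltnW.
- by constructor 2; exists i; rewrite // ltnS ltnW.
- by constructor 1; exists m; rewrite ?mem_u.
- by constructor 1; exists m.
- by constructor 2; exists m.
- by constructor 3.
Qed.

Lemma uniq_block m : m < k -> uniq (block m).
Proof.
move=> lt_mk; case: (lab) => /(_ m lt_mk) + _ wa _.
rewrite /= !inE !negb_or andbT => /andP[/andP[uz uw] zw].
case: ifP => [lt_mk1|]; last by rewrite zw.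
have [[_ + _ _ _] _] := tc_path hG lt_mk1; rewrite -/(uniq _) cons_uniq => /andP[ap p_uniq].
rewrite zw wa // ap -/(uniq _) p_uniq /= andbT.
apply/negP => /(mem_path lt_mk1)[zp|zu].
  by have := inner_C lt_mk1 lt_mk zp; rewrite mem_z.
have lt_Sk : m.+1 < k by lia.
have := C_disjoint lt_mk lt_Sk (mem_z lt_mk); rewrite zu mem_u // => /(_ isT); lia.
Qed.

(** A vertex common to [ham m] and [block m] would lie in two triangles, in two path interiors, or
    in a triangle and an interior, unless it is [u m], which the block avoids. *)
Lemma uniq_ham m : m <= k -> uniq (ham m).
Proof.
elim: m => // m IHm lt_mk; rewrite hamS cat_uniq IHm ?(ltnW lt_mk) // uniq_block // andbT.
apply/hasPn => v /(mem_block lt_mk) vB; apply/negP => /(mem_ham lt_mk) vH.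
have C_eq i j : i < k -> j < k -> v \in C i -> v \in C j -> i = j by apply: C_disjoint.
case: vB => [[vm vu] | [lt_mk1 vm] | [lt_mk1 def_v]].
- case: vH => [[i lt_im vi] | [i lt_im vi] | def_v]; last by rewrite def_v eqxx in vu.
    have := C_eq i m; rewrite (ltn_trans lt_im) // => /(_ isT lt_mk vi vm); lia.
  have lt_ik1 : i < k.-1 by lia.
  by have := inner_C lt_ik1 lt_mk vi; rewrite vm.
- case: vH => [[i lt_im vi] | [i lt_im vi] | def_v].
  + by have := inner_C lt_mk1 (ltn_trans lt_im lt_mk) vm; rewrite vi.
  + by have := inner_disjoint (_ : i < m < k.-1) vi; rewrite lt_im lt_mk1 vm => /(_ isT).
  + by have := inner_C lt_mk1 lt_mk vm; rewrite def_v mem_u.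
- have lt_Sk : m.+1 < k by lia.
  have vS : v \in C m.+1 by rewrite def_v mem_u.
  case: vH => [[i lt_im vi] | [i lt_im vi] | def_v'].
  + have := C_eq i m.+1 (ltn_trans lt_im lt_mk) lt_Sk vi vS; lia.
  + by have := inner_C (ltn_trans lt_im lt_mk1) lt_Sk vi; rewrite vS.
  + have := C_eq m m.+1 lt_mk lt_Sk; rewrite {1}def_v' mem_u // => /(_ isT vS); lia.
Qed.

Lemma ham_all v : v \in ham k.
Proof.
have in_block i : i < k -> {subset block i <= ham k}.
  move=> lt_ik x xi; rewrite /ham in_cons; apply/orP; right.
  by apply/flatten_mapP; exists i; rewrite // mem_iota.
have in_p i : i < k.-1 -> {subset p i <= ham k}.
  by move=> lt_i x xp; apply: (in_block i); [lia | rewrite !inE lt_i xp !orbT].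
have in_w i : i < k -> w i \in ham k.
  by move=> lt_i; apply: (in_block i lt_i); rewrite !inE eqxx orbT.
case: (tc_vertices hG v) => -[i lt_ik]; last first.
  move=> vP; rewrite inE in vP; case/predU1P: vP => [->|]; last exact: in_p.
  by case: (lab) => _ _ <- // _; apply: in_w; lia.
case: (lab) => _ -> // _ _ vC; rewrite !inE in vC; case/or3P: vC => /eqP->; last exact: in_w.
  case: i lt_ik => [|i] lt_ik; first by rewrite /ham inE eqxx.
  by apply: (in_p i); [lia | apply: mem_exit; lia].
by apply: (in_block i lt_ik); rewrite inE eqxx.
Qed.

Lemma size_ham_k : size (ham k) = n.
Proof.
rewrite -[RHS]card_ord -(eq_card (A := mem (ham k))) => [|v]; last by rewrite ham_all.
by rewrite (card_uniqP (uniq_ham (leqnn k))).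
Qed.

(** Each block contributes two vertices of its triangle and, except for the last, [r i] path
    vertices; the successor counts [u 0]. *)
Lemma vertex_count : n = (2 * k + \sum_(i < k.-1) r i).+1.
Proof.
have def_k : k = k.-1.+1 by lia.
rewrite -size_ham_k {1}def_k hamS size_cat size_ham // /block ltnn /=; lia.
Qed.

End Labelled.

Lemma hamiltonian_path : exists eta : nat -> 'I_n,
  [/\ forall i j, i < n -> j < n -> eta i = eta j -> i = j,
      forall v, exists2 i, i < n & v = eta i
    & forall i, i.+1 < n -> e (eta i) (eta i.+1)].
Proof.
have [u [z [w lab]]] := triangle_labelling_exists.
have size_n := size_ham_k lab.
exists (nth (u 0) (ham u z w k)); split=> [i j lt_i lt_j /eqP|v|i lt_i].
- by rewrite nth_uniq ?size_n ?(uniq_ham lab) // => /eqP.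
- exists (index v (ham u z w k)); last by rewrite nth_index ?(ham_all lab).
  by rewrite -[X in _ < X]size_n index_mem (ham_all lab).
- have /(pathP (u 0)) := ham_path lab (leqnn k); apply.
  by rewrite -[X in _ < X]size_n in lt_i.
Qed.

End TriangleChain.

(** * Equations for a chain of triangles *)

Lemma cut_out_by_seq (R : comNzRingType) (J : R -> Prop) (Fs : seq R) :
  is_ideal J -> (forall f, f \in Fs -> J f) ->
  subideal J (radical (ideal_gen (fun f => f \in Fs))) -> cut_out_by J (size Fs).
Proof.
move=> J_ideal FsJ J_rad; exists (tnth (in_tuple Fs)); split=> [i|f].
  by apply/FsJ/mem_tnth.
have genE : subideal (ideal_gen (fun f => f \in Fs))
    (ideal_gen (fun g => exists i, g = tnth (in_tuple Fs) i)).
  apply: ideal_gen_min; first exact: ideal_gen_is_ideal.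
  by move=> g /(tnthP (in_tuple Fs)) [i ->]; apply: mem_ideal_gen; exists i.
split; apply: radical_sub.
  by move=> g /J_rad [m /genE Fg]; exists m.
apply: ideal_gen_min; first exact: radical_is_ideal.
by move=> _ [i ->]; apply/sub_radical/FsJ/mem_tnth.
Qed.

Section EdgeBinomials.
Variables (K : fieldType) (n : nat).
Local Notation f := (@edge_binomial K n).
Local Open Scope ring_scope.

Lemma edge_binomialC i j : f j i = - f i j.
Proof. by rewrite /edge_binomial; ring. Qed.

Lemma edge_binomialxx i : f i i = 0.
Proof. exact: subrr. Qed.

Lemma edge_binomial_pluecker d z c q : f d z * f c q = f d c * f z q - f z c * f d q.
Proof. by rewrite /edge_binomial; ring. Qed.

(** Both elements are roots of a monic quadratic polynomial whose lower coefficients are, up to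
    sign, their sum and product. *)
Lemma radical_sum_of_products (I : {mpoly K[n + n]} -> Prop) g h :
  is_ideal (radical I) -> radical I (g * h) -> radical I (g + h) -> radical I g /\ radical I h.
Proof.
move=> I_ideal Igh Isum; have [_ _ IM] := I_ideal.
suff Ig : radical I g by split=> //; rewrite -[h](addKr g) addrC; apply: is_idealB.
apply: (@radical_idem _ _ _ 2); have -> : g ^+ 2 = g * (g + h) - g * h by ring.
by apply: is_idealB => //; apply: IM.
Qed.

End EdgeBinomials.

Section TriangleChainIdeal.
Variables (K : fieldType) (n : nat) (e : rel 'I_n) (k : nat) (r : nat -> nat).
Variables (C : nat -> seq 'I_n) (a : nat -> 'I_n) (p : nat -> seq 'I_n).
Hypothesis e_graph : connected_simple_graph e.
Hypothesis k_gt1 : 2 <= k.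
Hypothesis r_gt1 : forall i, i < k.-1 -> 2 <= r i.
Hypothesis hG : triangle_chain e k r C a p.
Local Notation f := (@edge_binomial K n).
Local Notation J := (binomial_edge_ideal K e).

Lemma mem_binomial_edge_ideal u v : e u v -> J (f u v).
Proof.
case: e_graph => e_sym e_irr _ euv.
have J_ideal : is_ideal J by apply: ideal_gen_is_ideal.
have [lt_uv | lt_vu | /val_inj def_u] := ltngtP u v.
- by apply: mem_ideal_gen; exists u, v.
- rewrite edge_binomialC; apply: is_idealN => //.
  by apply: mem_ideal_gen; exists v, u; rewrite -e_sym.
- by rewrite def_u e_irr in euv.
Qed.

(* [c i] is the vertex of the [i]-th triangle whose path edge absorbs the
   binomial of the opposite side [d i, z i]; for the last triangle this is the
   last edge of the last path. *)
Lemma cut_out_by_triangle_chain : cut_out_by J (2 * k + \sum_(i < k.-1) r i).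
Proof.
have [u [z [w lab]]] := triangle_labelling_exists k_gt1 hG.
case: (e_graph) => e_sym e_irr _; have [uzw_uniq CE wa ul] := lab.
pose c i := if i < k.-1 then w i else u i.
pose d i := if i < k.-1 then u i else w i.
have {}CE i : i < k -> C i =i [:: d i; z i; c i].
  move=> lt_ik v; rewrite CE // /d /c; case: ifP => // _.
  by rewrite !inE; do 3!case: eqP.
pose D i := f (d i) (z i).
pose node i j := nth (a i) (a i :: p i) j.
pose P i j := f (node i j) (node i j.+1).
(* The first edge of path [i] absorbs [D i], and the last edge of the last path, of index [k.-2],
   absorbs [D k.-1]. These edges are distinct because [r i >= 2]. *)
pose extra i j : {mpoly K[n + n]} :=
  if j == 0 then D i else if (i == k.-2) && (j == (r i).-1) then D k.-1 else 0%R.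
pose G i j := (P i j + extra i j)%R.
(* Two equations for each triangle and one for each path edge. *)
pose Fs := flatten [seq [:: f (d i) (c i); f (z i) (c i)] | i <- iota 0 k] ++
  flatten [seq [seq G i j | j <- iota 0 (r i)] | i <- iota 0 k.-1].
have size_Fs : size Fs = 2 * k + \sum_(i < k.-1) r i.
  rewrite size_cat !size_flatten /shape -!map_comp; congr (_ + _).
    by rewrite sumnE big_map -[X in iota 0 X]subn0 -/(index_iota 0 k) /=
      sum_nat_const_nat subn0 mulnC.
  rewrite sumnE big_map -[X in iota 0 X]subn0 big_mkord.
  by apply: eq_bigr => i _; rewrite /= size_map size_iota.
have J_ideal : is_ideal J by apply: ideal_gen_is_ideal.
have J_C i v v' : i < k -> v \in C i -> v' \in C i -> J (f v v').
  move=> lt_ik vC v'C; have [->|vv'] := eqVneq v v'.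
    by rewrite edge_binomialxx; case: J_ideal.
  exact/mem_binomial_edge_ideal/(triangle_adj e_sym (tc_cycle hG lt_ik)).
have memC i : i < k -> [/\ d i \in C i, z i \in C i & c i \in C i].
  by move=> lt_ik; rewrite !CE // !inE !eqxx !orbT.
have J_D i : i < k -> J (D i) by move=> lt_ik; have [? ? ?] := memC i lt_ik; apply: (J_C i).
have J_P i j : i < k.-1 -> j < r i -> J (P i j).
  move=> lt_ik lt_jr; have [[/(pathP (a i)) p_e _ _ _ _] size_p] := tc_path hG lt_ik.
  by apply: mem_binomial_edge_ideal; apply: p_e; rewrite size_p.
rewrite -size_Fs; apply: cut_out_by_seq => // [g|].
  rewrite mem_cat => /orP[] /flatten_mapP[i]; rewrite mem_iota add0n => lt_ik.
    have [? ? ?] := memC i lt_ik.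
    by rewrite !inE => /orP[] /eqP->; apply: (J_C i).
  case/mapP=> j; rewrite mem_iota add0n => lt_jr ->; case: (J_ideal) => J0 JD _.
  apply: JD; first exact: J_P.
  by rewrite /extra; case: ifP => _; [|case: ifP => // _]; apply: J_D; lia.
set I := ideal_gen _.
have I_ideal : is_ideal (radical I) by apply/radical_is_ideal/ideal_gen_is_ideal.
have [I0 ID IM] := I_ideal.
have I_Fs g : g \in Fs -> radical I g by move=> gF; apply/sub_radical/mem_ideal_gen.
have I_dc i : i < k -> radical I (f (d i) (c i)).
  move=> lt_ik; apply: I_Fs; rewrite mem_cat; apply/orP; left.
  by apply/flatten_mapP; exists i; rewrite ?mem_iota // !inE eqxx.
have I_zc i : i < k -> radical I (f (z i) (c i)).
  move=> lt_ik; apply: I_Fs; rewrite mem_cat; apply/orP; left.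
  by apply/flatten_mapP; exists i; rewrite ?mem_iota // !inE eqxx orbT.
have I_G i j : i < k.-1 -> j < r i -> radical I (G i j).
  move=> lt_ik lt_jr; apply: I_Fs; rewrite mem_cat; apply/orP; right.
  by apply/flatten_mapP; exists i; rewrite ?mem_iota //; apply/mapP; exists j; rewrite ?mem_iota.
(* In the Pluecker relation, each term on the right has a factor [f (d i) (c i)] or [f (z i) (c i)],
   whatever [q] is. *)
have I_Dc i q : i < k -> radical I (D i * f (c i) q)%R.
  move=> lt_ik; rewrite edge_binomial_pluecker.
  by apply: (is_idealB I_ideal); rewrite mulrC; apply: IM; [exact: I_dc | exact: I_zc].
have I_first i : i < k.-1 -> radical I (D i) /\ radical I (P i 0).
  move=> lt_ik; have lt_0r : 0 < r i by apply: ltnW (r_gt1 lt_ik).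
  have lt_ik' : i < k by lia.
  apply: (radical_sum_of_products I_ideal); last by rewrite addrC; exact: (I_G i 0 lt_ik lt_0r).
  have def_c : c i = a i by rewrite /c lt_ik (wa i lt_ik).
  have := I_Dc i (node i 1) lt_ik'; rewrite def_c; exact.
(* The absorbing edge ends at [c k.-1] instead of starting there, so the relation applies up to
   sign. *)
have I_last : radical I (D k.-1) /\ radical I (P k.-2 (r k.-2).-1).
  have lt_k2 : k.-2 < k.-1 by lia.
  have r_gt1' := r_gt1 lt_k2; have [_ size_p] := tc_path hG lt_k2.
  have def_r : (r k.-2) = (r k.-2).-1.+1 by lia.
  have lt_k1 : k.-1 < k by lia.
  apply: (radical_sum_of_products I_ideal); last first.
    have lt_jr : (r k.-2).-1 < r k.-2 by lia.
    have /negPf j_neq0 : (r k.-2).-1 != 0 by lia.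
    by have := I_G k.-2 _ lt_k2 lt_jr; rewrite /G /extra j_neq0 !eqxx addrC.
  have node_last : node k.-2 (r k.-2).-1.+1 = c k.-1.
    rewrite -def_r /c ltnn (_ : k.-1 = k.-2.+1) ?ul //; last by lia.
    by rewrite /node -size_p -[size (p _)]/((size (a k.-2 :: p k.-2)).-1) nth_last.
  rewrite /P node_last edge_binomialC mulrN; apply: (is_idealN I_ideal).
  exact: I_Dc lt_k1.
have I_D i : i < k -> radical I (D i).
  move=> lt_ik; have [/I_first[] // | le_ki] := ltnP i k.-1.
  by rewrite (_ : i = k.-1); [case: I_last | lia].
have I_P i j : i < k.-1 -> j < r i -> radical I (P i j).
  move=> lt_ik lt_jr; have := I_G i j lt_ik lt_jr; rewrite /G /extra.
  have [->|_] := eqVneq j 0; first by case: (I_first i lt_ik).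
  case: andP => [[/eqP-> /eqP->]|_]; first by case: I_last.
  by rewrite addr0.
have I_C i v v' : i < k -> v \in C i -> v' \in C i -> radical I (f v v').
  have I_sym v1 v2 : radical I (f v1 v2) -> radical I (f v2 v1).
    by move=> I_v; rewrite edge_binomialC; apply: is_idealN.
  have I_xx v1 : radical I (f v1 v1) by rewrite edge_binomialxx.
  move=> lt_ik; have I_dz : radical I (f (d i) (z i)) := I_D i lt_ik.
  have {I_D I_dc I_zc} [I_dc I_zc] := (I_dc i lt_ik, I_zc i lt_ik).
  rewrite !(CE i lt_ik) !inE => vC v'C; case/or3P: vC v'C => /eqP-> /or3P[] /eqP->.
  - exact: I_xx.
  - exact: I_dz.
  - exact: I_dc.
  - exact/I_sym/I_dz.
  - exact: I_xx.
  - exact: I_zc.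
  - exact/I_sym/I_dc.
  - exact/I_sym/I_zc.
  - exact: I_xx.
have I_infix i v v' : i < k.-1 -> infix [:: v; v'] (a i :: p i) -> radical I (f v v').
  move=> lt_ik /infixP[s1 [s2 def_p]]; have [_ size_p] := tc_path hG lt_ik.
  have := congr1 size def_p; rewrite !size_cat /= size_p => def_r.
  have nth0 : node i (size s1) = v by rewrite /node def_p nth_cat ltnn subnn.
  have nth1 : node i (size s1).+1 = v' by rewrite /node def_p nth_cat ltnNge leqnSn subSnn.
  have := I_P i (size s1) lt_ik; rewrite /P nth0 nth1; apply.
  by rewrite -ltnS def_r addnCA add2n !ltnS leq_addr.
apply: (ideal_gen_min I_ideal) => _ [v [v' [_ evv' ->]]].
case: (tc_edges hG evv') => -[i lt_ik].
  by case/orP=> /andP[vC /eqP->]; apply: (I_C i) => //; rewrite mem_next.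
case/orP=> vv'; first exact: (I_infix i).
by rewrite edge_binomialC; apply: (is_idealN I_ideal); apply: (I_infix i).
Qed.

End TriangleChainIdeal.

Theorem theorem3p13 (K : fieldType) (n : nat) (e : rel 'I_n)
    (he : connected_simple_graph e)
    (k : nat) (hk : 2 <= k) (r : nat -> nat)
    (hr : forall i, i < k.-1 -> 2 <= r i)
    (C : nat -> seq 'I_n) (a : nat -> 'I_n) (p : nat -> seq 'I_n)
    (hG : triangle_chain e k r C a p) :
  [/\ arithmetical_rank (binomial_edge_ideal K e) (2 * k + \sum_(i < k.-1) r i),
      height (binomial_edge_ideal K e) (2 * k + \sum_(i < k.-1) r i)
    & set_theoretic_complete_intersection (binomial_edge_ideal K e)].
Proof.
set s := 2 * k + _; set J := binomial_edge_ideal K e.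
have def_s : s = n.-1.
  have [u [z [w lab]]] := triangle_labelling_exists hk hG.
  exact/esym/(congr1 predn (vertex_count hk hr hG lab)).
have [eta [eta_inj eta_surj eta_e]] := hamiltonian_path he hk hr hG.
have J_path i : i.+1 < n -> J (edge_binomial K (eta i) (eta i.+1)).
  by move=> lt_in; apply/mem_binomial_edge_ideal/eta_e.
have J_min I : is_ideal I -> (forall i j, I (edge_binomial K i j)) -> subideal J I.
  by move=> I_ideal I_edge; apply: ideal_gen_min => // _ [i [j [_ _ ->]]].
have ara : arithmetical_rank J s.
  split; first exact: (cut_out_by_triangle_chain K he hk hr hG).
  move=> t; rewrite def_s; exact: (arithmetical_rank_path_ideal_ge eta_surj J_path J_min).
have ht : height J s.
  rewrite def_s; apply: (height_path_ideal eta_inj _ J_path J_min).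
  by apply: leq_ltn_trans (ltn_ord (eta 0)).
by split=> //; exists s.
Qed.
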